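(* Let the sequence of random graphs $G_1,G_2,\dots$ be generated by the clustering attachment model $CA^{(\alpha,\epsilon)}$ (without node and edge deletion) with initial graph $G_0$ and parameters $\alpha>0$, $\epsilon\ge 0$ and $m_0=2$. Let $\mathcal{F}_t=\sigma\{G_0,G_1,\dots,G_t\}$, $t=0,1,2,\dots$, and let $k_{i,t}$ be the degree of node $i$ in $G_t$. Then for any fixed node $i$, the sequence $(k_{i,0},\mathcal{F}_0),(k_{i,1},\mathcal{F}_1),\dots$ is a submartingale.
   Context: Notation: for a finite set $A$, $\|A\|$ is its cardinality. All graphs are finite, undirected and simple; $G_0=(V_0,E_0)$ is a given (non-random) graph with $V_0=\{1,\dots,\|V_0\|\}$. Clustering coefficients: for a node $i\in V_t$ of $G_t=(V_t,E_t)$ let $k_{i,t}$ be its degree and $\Delta_{i,t}$ the number of triangles of $G_t$ containing $i$ (equivalently, the number of edges between neighbours of $i$). Set $c_{i,t}=0$ if $k_{i,t}\in\{0,1\}$ and $c_{i,t}=2\Delta_{i,t}/(k_{i,t}(k_{i,t}-1))$ if $k_{i,t}\ge 2$. Model $CA^{(\alpha,\epsilon)}$ with $\alpha>0$, $\epsilon\ge0$, $m_0=2$, without node and edge deletion: for $t\ge 0$, $G_{t+1}$ is obtained from $G_t$ by (i) appending a new node $\|V_0\|+t+1$; (ii) choosing a set $W_t\subset V_t$ of $m_0=2$ distinct nodes by weighted sampling without replacement with weights $$P_{CA}(i,t)=\frac{c_{i,t}^{\alpha}+\epsilon}{\sum_{j\in V_t}c_{j,t}^{\alpha}+\|V_t\|\epsilon},\qquad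 i\in V_t,$$ and adding the two edges joining the new node to the two nodes of $W_t$. No other changes are made. Thus $V_t=\{1,\dots,\|V_0\|+t\}$. Weighted sampling without replacement of two nodes means: given the graphs up to step $t$, the first node is $i$ with probability $P_{CA}(i,t)$; given that the first node is $i$, the second node is $j\ne i$ with probability $P_{CA}(j,t)/(1-P_{CA}(i,t))$. $W_t$ is the resulting unordered pair. Standing assumption on $G_0$: if $\epsilon>0$, then $\|V_0\|\ge m_0=2$; if $\epsilon=0$, then $\|\tilde V_0\|\ge m_0=2$, where $\tilde V_0=\{i\in V_0: c_{i,0}>0\}$. Convention for nodes not yet present: a node $i$ is any element of $\{1,2,3,\dots\}$, and for $t\ge1$, $k_{\|V_0\|+t,s}=0$ for $0\le s<t$. *)

(* Defs.v *)
From HB Require Import structures.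
From mathcomp Require Import all_boot all_order all_algebra.
From mathcomp Require Import all_classical all_reals all_analysis.
Set Implicit Arguments.
Unset Strict Implicit.
Unset Printing Implicit Defensive.
Import Order.TTheory GRing.Theory Num.Theory.
Local Open Scope classical_set_scope.
Local Open Scope ring_scope.

(* Simple graphs on the node set {1, ..., n}: the ordinal x : 'I_n stands for
   the node labelled x.+1. *)
Record sgraph (n : nat) := SGraph {
  adj : rel 'I_n;
  adj_sym : symmetric adj;
  adj_irr : irreflexive adj }.

Definition degree (n : nat) (g : sgraph n) (x : 'I_n) : nat :=
  #|[set y | adj g x y]%SET|.

(* The sum has one term when 1 <= i <= n and none otherwise, so that a node
   which is not (yet) in the graph has degree 0. *)
Definition node_degree (n : nat) (g : sgraph n) (i : nat) : nat :=
  (\sum_(x < n | x.+1 == i) degree g x)%N.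

Definition triangles (n : nat) (g : sgraph n) (x : 'I_n) : nat :=
  #|[set T : {set 'I_n} | [&& #|T| == 3%N, x \in T &
      [forall y in T, forall z in T, (y != z) ==> adj g y z]]]%SET|.

Definition clustering (R : realType) (n : nat) (g : sgraph n) (x : 'I_n) : R :=
  if (degree g x <= 1)%N then 0
  else 2 * (triangles g x)%:R / ((degree g x)%:R * ((degree g x)%:R - 1)).

Definition attach_rel (n : nat) (g : sgraph n) (S : {set 'I_n}) :
    rel 'I_n.+1 := fun x y =>
  match unlift ord_max x, unlift ord_max y with
  | Some a, Some b => adj g a b
  | Some a, None => a \in S
  | None, Some b => b \in S
  | None, None => false
  end.

Lemma attach_sym (n : nat) (g : sgraph n) (S : {set 'I_n}) :
  symmetric (attach_rel g S).
Proof.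
move=> x y; rewrite /attach_rel.
by case: unliftP => [a _|_]; case: unliftP => [b _|_] //; exact: adj_sym.
Qed.

Lemma attach_irr (n : nat) (g : sgraph n) (S : {set 'I_n}) :
  irreflexive (attach_rel g S).
Proof.
by move=> x; rewrite /attach_rel; case: unliftP => [a _|//]; exact: adj_irr.
Qed.

(* The new node, labelled n.+1, is the ordinal ord_max : 'I_n.+1; the old nodes
   keep their labels, since lift ord_max a has the same value as a. *)
Definition attach (n : nat) (g : sgraph n) (S : {set 'I_n}) : sgraph n.+1 :=
  SGraph (attach_sym g S) (attach_irr g S).

Definition CA_prob (R : realType) (alpha eps : R) (n : nat) (g : sgraph n)
    (x : 'I_n) : R :=
  (clustering R g x `^ alpha + eps) /
  (\sum_(y < n) clustering R g y `^ alpha + n%:R * eps).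

(* Probability that two successive draws without replacement, with weights p,
   yield the unordered pair S: sum over the ordered draws (x, y). *)
Definition sample2_prob (R : realType) (n : nat) (p : 'I_n -> R)
    (S : {set 'I_n}) : R :=
  \sum_(x < n) \sum_(y < n | (y != x) && ([set x; y]%SET == S))
    p x * (p y / (1 - p x)).

Definition CA_initial (R : realType) (eps : R) (n0 : nat) (G0 : sgraph n0) :
    Prop :=
  (0 < eps -> (2 <= n0)%N) /\
  (eps = 0 -> (2 <= #|[set x | (0 < clustering R G0 x)%R]%SET|)%N).

(* The index t + n0 (rather than n0 + t) makes sgraph (t.+1 + n0) convertible
   to sgraph (t + n0).+1, and sgraph (0 + n0) to sgraph n0.  There are finitely
   many graphs of each order, whence the discrete sigma-algebra. *)
Definition graph_filtration (T : Type) (n0 : nat)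
    (G : forall t : nat, T -> sgraph (t + n0)) (t : nat) : set (set T) :=
  <<s [set A | exists s (B : set (sgraph (s + n0))),
         (s <= t)%N /\ A = G s @^-1` B] >>.

Definition measurable_wrt (R : realType) (T : Type) (F : set (set T))
    (X : T -> R) : Prop :=
  forall B : set R, measurable B -> F (X @^-1` B).

(* Y is a version of the conditional expectation E[X | F]. *)
Definition cond_exp (R : realType) (d : measure_display)
    (T : measurableType d) (P : probability T R) (F : set (set T))
    (X Y : T -> R) : Prop :=
  [/\ measurable_wrt F Y,
      P.-integrable setT (EFin \o Y) &
      forall A, F A ->
        (\int[P]_(w in A) (Y w)%:E = \int[P]_(w in A) (X w)%:E)%E].

Definition filtration (d : measure_display) (T : measurableType d)
    (F : nat -> set (set T)) : Prop :=
  [/\ forall t, sigma_algebra setT (F t),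
      forall t, F t `<=` measurable &
      forall s t, (s <= t)%N -> F s `<=` F t].

Definition submartingale (R : realType) (d : measure_display)
    (T : measurableType d) (P : probability T R) (F : nat -> set (set T))
    (X : nat -> T -> R) : Prop :=
  [/\ filtration F,
      forall t, measurable_wrt (F t) (X t),
      forall t, P.-integrable setT (EFin \o X t) &
      forall t, exists Y : T -> R,
        cond_exp P (F t) (X t.+1) Y /\ {ae P, forall w, X t w <= Y w}].

(* W t is the random pair of nodes to which the node added at step t + 1 is
   joined; its law is prescribed conditionally on the graphs up to step t. *)
Record CA_process (R : realType) (d : measure_display) (T : measurableType d)
    (P : probability T R) (alpha eps : R) (n0 : nat) (G0 : sgraph n0)
    (G : forall t : nat, T -> sgraph (t + n0))
    (W : forall t : nat, T -> {set 'I_(t + n0)}) : Prop := {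
  CA_graph_measurable : forall t (B : set (sgraph (t + n0))),
    measurable (G t @^-1` B);
  CA_pair_measurable : forall t (B : set {set 'I_(t + n0)}),
    measurable (W t @^-1` B);
  CA_start : forall w, G 0%N w = G0;
  CA_pair_card : forall t w, #|W t w| = 2%N;
  CA_step : forall t w, G t.+1 w = attach (G t w) (W t w);
  CA_pair_law : forall t (S : {set 'I_(t + n0)}),
    cond_exp P (graph_filtration G t) (\1_(W t @^-1` [set S]))
      (fun w => sample2_prob (CA_prob alpha eps (G t w)) S) }.

(* Main.v *)
(** Attaching a node to the pair [W_t] changes the degree of node [i] by
    [1_{i \in W_t}], plus [2] if [i] is the new node.  The conditional
    expectation of [1_{i \in W_t}] given [F_t] is the sum of the selection
    probabilities of the pairs containing [i], which is nonnegative. *)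
Require Import Defs.
From HB Require Import structures.
From mathcomp Require Import all_boot all_order all_algebra.
From mathcomp Require Import all_classical all_reals all_analysis.
Set Implicit Arguments.
Unset Strict Implicit.
Unset Printing Implicit Defensive.
Import Order.TTheory GRing.Theory Num.Theory.
Local Open Scope classical_set_scope.
Local Open Scope ring_scope.

(** Bridges two embeddings of the old nodes: [big_ord_recr] produces [widen_ord], while [attach_rel]
    is read through [unlift ord_max]. *)
Lemma widen_ord_lift (n : nat) (x : 'I_n) :
  widen_ord (leqnSn n) x = lift ord_max x.
Proof. by apply: val_inj; rewrite /= /bump leqNgt ltn_ord. Qed.

Lemma degree_attach_old (n : nat) (g : sgraph n) (S : {set 'I_n}) (x : 'I_n) :
  degree (attach g S) (lift ord_max x) = (degree g x + (x \in S))%N.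
Proof.
rewrite /degree -!sum1dep_card big_mkcond big_ord_recr /= -big_mkcond /=.
congr (_ + _)%N.
  by apply: eq_bigl => y; rewrite widen_ord_lift /attach_rel !liftK.
by rewrite /attach_rel liftK unlift_none; case: (x \in S).
Qed.

Lemma degree_attach_new (n : nat) (g : sgraph n) (S : {set 'I_n}) :
  degree (attach g S) ord_max = #|S|.
Proof.
rewrite /degree -sum1dep_card big_mkcond big_ord_recr /= -big_mkcond /=.
rewrite /attach_rel unlift_none addn0.
by rewrite -sum1_card; apply: eq_bigl => y; rewrite widen_ord_lift liftK.
Qed.

(** Takes a label instead of an ordinal, so that it is simply false when node [i] is not yet
    present. *)
Definition has_label (n : nat) (i : nat) (S : {set 'I_n}) : bool :=
  [exists x, (x \in S) && (x.+1 == i)].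

Lemma node_degree_attach (n : nat) (g : sgraph n) (S : {set 'I_n}) (i : nat) :
  node_degree (attach g S) i =
  (node_degree g i + #|S| * (i == n.+1) + has_label i S)%N.
Proof.
rewrite /node_degree big_mkcond big_ord_recr /= -big_mkcond /=.
rewrite degree_attach_new [(i == _)]eq_sym -addnA [X in (_ = _ + X)%N]addnC.
rewrite addnA; congr (_ + _)%N; last by case: eqP => _; rewrite ?muln1 ?muln0.
under eq_bigr do rewrite widen_ord_lift degree_attach_old.
rewrite big_split; congr (_ + _)%N.
(* At most one ordinal carries the label [i]; if none does, the sum is empty and [has_label] is
   false. *)
case: (pickP (fun x : 'I_n => x.+1 == i)) => [x xi|no]; last first.
  rewrite big_pred0 //; suff -> : has_label i S = false by [].
  by apply/existsP => -[x /andP[_]]; rewrite no.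
rewrite (big_pred1 x) => [|y]; last first.
  by rewrite -(eqP xi) eqSS; apply/eqP/eqP => [/val_inj|->].
congr nat_of_bool; apply/idP/existsP => [xS|[y /andP[yS yi]]].
  by exists x; rewrite xS.
suff -> : x = y by [].
by apply: val_inj; apply/eq_add_S; rewrite (eqP xi) (eqP yi).
Qed.

Lemma node_degree_bound (n : nat) (g : sgraph n) (i : nat) :
  (node_degree g i <= n * n)%N.
Proof.
rewrite /node_degree big_mkcond /= -[X in (X * _)%N]card_ord -sum_nat_const.
apply: leq_sum => x _; case: eqP => // _.
by rewrite /degree (leq_trans (max_card _)) ?card_ord.
Qed.

(** The numerator is one of the [n] nonnegative terms that add up to the denominator. *)
Lemma CA_prob_bounds (R : realType) (alpha eps : R) (n : nat) (g : sgraph n)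
    (x : 'I_n) : 0 <= eps -> 0 <= CA_prob alpha eps g x <= 1.
Proof.
move=> eps0; rewrite /CA_prob.
set s := _ + n%:R * eps; have s0 : 0 <= s.
  by rewrite addr_ge0 ?mulr_ge0 // sumr_ge0 // => y _; exact: powR_ge0.
rewrite divr_ge0 //=; last by rewrite addr_ge0 ?powR_ge0.
have le_s : clustering R g x `^ alpha + eps <= s.
  apply: lerD.
    rewrite (bigD1 x) //= lerDl sumr_ge0 // => y _; exact: powR_ge0.
  by rewrite ler_peMl // ler1n (leq_trans _ (ltn_ord x)).
(* If all weights vanish, the convention that the inverse of 0 is 0 makes the quotient 0. *)
have [->|sN0] := eqVneq s 0; first by rewrite invr0 mulr0.
by rewrite ler_pdivrMr ?mul1r // lt_neqAle eq_sym sN0 s0.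
Qed.

(** The bound [p x <= 1] keeps the denominator [1 - p x] nonnegative; for [p x = 1] the quotient is
    0. *)
Lemma sample2_prob_ge0 (R : realType) (n : nat) (p : 'I_n -> R)
    (S : {set 'I_n}) : (forall x, 0 <= p x <= 1) -> 0 <= sample2_prob p S.
Proof.
move=> p01; apply: sumr_ge0 => x _; apply: sumr_ge0 => y _.
have /andP[x0 x1] := p01 x; have /andP[y0 _] := p01 y.
by rewrite mulr_ge0 // divr_ge0 // subr_ge0.
Qed.

Lemma graph_filtrationP (d : measure_display) (T : measurableType d) (n0 : nat)
    (G : forall t : nat, T -> sgraph (t + n0)) :
  (forall t (B : set (sgraph (t + n0))), measurable (G t @^-1` B)) ->
  filtration (graph_filtration G).
Proof.
move=> mG; split=> [t|t|s t st]; first exact: smallest_sigma_algebra.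
  apply: smallest_sub; first exact: sigma_algebra_measurable.
  by move=> _ [s [B [_ ->]]]; exact: mG.
apply: sub_sigma_algebra2 => _ [u [B [us ->]]].
by exists u, B; rewrite (leq_trans us).
Qed.

(** Graphs carry the discrete sigma-algebra, so [f] may be arbitrary: each preimage is already a
    generator. *)
Lemma graph_function_measurable (R : realType) (T : Type) (n0 : nat)
    (G : forall t : nat, T -> sgraph (t + n0)) (t : nat)
    (f : sgraph (t + n0) -> R) :
  measurable_wrt (graph_filtration G t) (f \o G t).
Proof.
by move=> B _; apply: sub_sigma_algebra; exists t, (f @^-1` B).
Qed.

Lemma bounded_nat_integrable (R : realType) (d : measure_display)
    (T : measurableType d) (P : probability T R) (X : T -> nat) (M : nat) :
  (forall B : set nat, measurable (X @^-1` B)) -> (forall w, (X w <= M)%N) ->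
  P.-integrable setT (EFin \o (fun w => (X w)%:R)).
Proof.
move=> mX bX.
apply: (le_integrable _ _ _ (finite_measure_integrable_cst P M%:R measurableT)).
- exact: measurableT.
- apply/measurable_realfun.measurable_EFinP => _ B mB; rewrite setTI.
  exact: (mX ((fun k : nat => k%:R) @^-1` B)).
- by move=> w _ /=; rewrite lee_fin !ger0_norm ?ler_nat.
Qed.

(** Linearity of conditional expectation, with a summand [Z] left unchanged. Measurability is asked
    of the whole candidate, which in the application is a function of the current graph. *)
Lemma cond_expD_sum (R : realType) (d : measure_display)
    (T : measurableType d) (P : probability T R) (F : set (set T))
    (I : Type) (s : seq I) (Z : T -> R) (X Y : I -> T -> R) :
  F `<=` measurable ->
  P.-integrable setT (EFin \o Z) ->
  (forall i, P.-integrable setT (EFin \o X i)) ->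
  (forall i, cond_exp P F (X i) (Y i)) ->
  measurable_wrt F (fun w => Z w + \sum_(i <- s) Y i w) ->
  cond_exp P F (fun w => Z w + \sum_(i <- s) X i w)
    (fun w => Z w + \sum_(i <- s) Y i w).
Proof.
move=> FM iZ iX XY mY.
have iY i : P.-integrable setT (EFin \o Y i) by case: (XY i).
(* Stated for a generic family [U], as it serves for both [X] and [Y]; the two sides are then
   compared term by term. *)
have integralE U A : measurable A ->
    (forall i : I, P.-integrable setT (EFin \o U i)) ->
    (\int[P]_(w in A) (Z w + \sum_(i <- s) U i w)%:E =
     \int[P]_(w in A) (Z w)%:E + \sum_(i <- s) \int[P]_(w in A) (U i w)%:E)%E.
  move=> mA iU.
  have iA f : P.-integrable setT f -> P.-integrable A f.
    by move=> /integrableS; apply.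
  under eq_integral do rewrite EFinD -sumEFin.
  rewrite integralD //; [|exact: iA|]; last first.
    by apply: integrable_sum => // i _; exact/iA/iU.
  by rewrite integral_sum // => i; exact/iA/iU.
split=> //.
- have -> : EFin \o (fun w => Z w + \sum_(i <- s) Y i w) =
      ((EFin \o Z) \+ (fun w => (\sum_(i <- s) (Y i w)%:E)%R))%E.
    by apply/funext => w /=; rewrite sumEFin.
  by apply: integrableD => //; apply: integrable_sum => // i _; exact: iY.
- move=> A FA; rewrite !integralE //; try exact: FM.
  by congr (_ + _)%E; apply: eq_bigr => i _; case: (XY i) => _ _; exact.
Qed.

Theorem proposition3 (R : realType) (d : measure_display)
    (T : measurableType d) (P : probability T R)
    (alpha eps : R) (halpha : 0 < alpha) (heps : 0 <= eps)
    (n0 : nat) (G0 : sgraph n0) (hG0 : CA_initial eps G0)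
    (G : forall t : nat, T -> sgraph (t + n0))
    (W : forall t : nat, T -> {set 'I_(t + n0)})
    (hCA : CA_process P alpha eps G0 G W)
    (i : nat) (hi : (0 < i)%N) :
  submartingale P (graph_filtration G)
    (fun t w => (node_degree (G t w) i)%:R).
Proof.
case: hCA => mG mW _ cardW stepG lawW.
have [sF FM monoF] := graph_filtrationP mG.
(* The shift [c] covers both the degree itself ([c = 0]) and the degree increased by the
   contribution of a new node. *)
have iX t (c : nat) : P.-integrable setT
    (EFin \o (fun w => (node_degree (G t w) i + c)%:R)).
  apply: (@bounded_nat_integrable _ _ _ _ _ ((t + n0) * (t + n0) + c)) => [B|w].
    exact: (mG t ((fun g => node_degree g i + c)%N @^-1` B)).
  by rewrite leq_add2r node_degree_bound.
split=> // t.
- exact: (graph_function_measurable (fun g => (node_degree g i)%:R)).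
- by have := iX t 0%N; under [X in EFin \o X]eq_fun do rewrite addn0.
(* The deterministic part of the increment: 2 exactly when [i] is the node added at step [t + 1]. *)
pose c := (2 * (i == (t + n0).+1))%N.
pose pairs := [seq S <- enum {set 'I_(t + n0)} | has_label i S].
pose q (g : sgraph (t + n0)) S : R := sample2_prob (CA_prob alpha eps g) S.
exists (fun w =>
  (node_degree (G t w) i + c)%:R + \sum_(S <- pairs) q (G t w) S).
split; last first.
  apply: aeW => w; rewrite natrD -addrA lerDl addr_ge0 // sumr_ge0 // => S _.
  by apply: sample2_prob_ge0 => x; exact: CA_prob_bounds.
(* The random part of the increment is split over the disjoint events [W t w = S], whose conditional
   probabilities are prescribed; only the term [S = W t w] can be nonzero. *)
have -> : (fun w => (node_degree (G t.+1 w) i)%:R) =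
    (fun w => (node_degree (G t w) i + c)%:R +
      \sum_(S <- pairs) \1_(W t @^-1` [set S]) w) :> (T -> R).
  apply/funext => w; rewrite stepG node_degree_attach cardW natrD.
  congr (_ + _); rewrite big_filter big_enum_cond /=.
  under eq_bigr do rewrite indicE.
  have inW S : (w \in W t @^-1` [set S]) = (S == W t w).
    by apply/idP/eqP => [/set_mem|] /= -> //; exact/mem_set.
  under eq_bigr do rewrite inW.
  rewrite -natr_sum; congr _%:R; rewrite big_mkcond (bigD1 (W t w)) //= eqxx.
  rewrite big1 ?addn0 => [|S /negbTE->]; last by rewrite if_same.
  by case: has_label.
apply: cond_expD_sum => // [S|].
  exact/integrable_indic/mW.
exact: (graph_function_measurable
  (fun g => (node_degree g i + c)%:R + \sum_(S <- pairs) q g S)).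
Qed.
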